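(* Let $F$ be a graded field and $D$ a graded central division algebra over $F$. Then there is a graded factor set $(\omega,f)$ of $H:=\Gamma_D/\Gamma_F$ in $D_0F$ such that $D=(D_0F,H,(\omega,f))$, the generalized graded crossed product associated to $(\omega,f)$.
   Context: Gradings are by torsion-free (totally ordered) abelian groups. For a graded ring $R=\bigoplus_\gamma R_\gamma$, $\Gamma_R$ is its support $\{\gamma:R_\gamma\ne0\}$, $gr(x)=\gamma$ for $0\ne x\in R_\gamma$, and $R^*$ is the group of units. A graded field (resp. graded division algebra) is a commutative graded ring (resp. graded ring) in which every nonzero homogeneous element is invertible; its units are exactly the nonzero homogeneous elements. A graded central division algebra over a graded field $F$ is a graded division algebra $D$ with center $F$ (as graded ring) and $[D:F]<\infty$. $D_0F$ is the graded subalgebra of $D$ generated by $D_0$ and $F$; its center is $Z(D_0)F$. $\Gamma_D/\Gamma_F$ acts on $Z(D_0)F$ by $\bar\gamma(a)=xax^{-1}$, where $x\in D^*$ is any element with $gr(x)+\Gamma_F=\bar\gamma$. Let $A$ be a graded central simple algebra over a graded field $L$ and $H$ a finite group acting on $L$ by graded (grade-preserving) automorphisms; let $GAut(A)_0$ be the group of grade-preserving ring automorphisms of $A$. A graded factor set of $H$ in $A$ is a pair of maps $\omega:H\to GAut(A)_0$, $f:H\times H\to A^*$ with $\omega_\sigma|_L=\sigma$, $\omega_\sigma\omega_\tau=Inn(f(\sigma,\tau))\omega_{\sigma\tau}$ where $Inn(c)(a)=cac^{-1}$, and $f(\sigma,\tau)f(\sigma\tau,\mu)=\omega_\sigma(f(\tau,\mu))f(\sigma,\tau\mu)$.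 The generalized (graded) crossed product is $(A,H,(\omega,f))=\bigoplus_{\sigma\in H}Ax_\sigma$, a free left $A$-module with basis $(x_\sigma)$ and multiplication determined by $x_\sigma a=\omega_\sigma(a)x_\sigma$ and $x_\sigma x_\tau=f(\sigma,\tau)x_{\sigma\tau}$, graded so that the grading extends that of $A$ and the $x_\sigma$ are homogeneous. *)

(* Defs.v *)
From HB Require Import structures.
From mathcomp Require Import all_boot all_order all_fingroup all_algebra.
From mathcomp Require Import boolp classical_sets.

Set Implicit Arguments.
Unset Strict Implicit.
Unset Printing Implicit Defensive.

Import GRing.Theory.
Local Open Scope classical_set_scope.
Local Open Scope ring_scope.
Local Open Scope quotient_scope.

(* Equivalently, V carries a translation-invariant total order. *)
Definition torsion_free (V : zmodType) : Prop :=
  forall (n : nat) (x : V), x *+ n.+1 = 0 -> x = 0.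

Definition sums (R : nzRingType) (P : set R) : set R :=
  [set x | exists2 s : seq R, {in s, forall y, P y} & x = \sum_(y <- s) y].

Record grading (V : zmodType) (R : nzRingType) := Grading {
  gpart :> V -> set R;
  gpart0 : forall g, gpart g 0;
  gpartB : forall g x y, gpart g x -> gpart g y -> gpart g (x - y);
  gpart1 : gpart 0 1;
  gpartM : forall g h x y, gpart g x -> gpart h y -> gpart (g + h) (x * y);
  gpart_span : forall x, sums [set y | exists g, gpart g y] x;
  gpart_free : forall (s : seq V) (c : V -> R), uniq s ->
    (forall g, gpart g (c g)) -> \sum_(g <- s) c g = 0 ->
    {in s, forall g, c g = 0}
}.

Definition homogeneous V R (gr : grading V R) (x : R) : Prop :=
  exists g, gr g x.

Definition supp V R (gr : grading V R) : set V :=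
  [set g | exists2 x, gr g x & x != 0].

Definition gr_division V (R : unitRingType) (gr : grading V R) : Prop :=
  forall g x, gr g x -> x != 0 -> x \is a GRing.unit.

Section SumsTheory.
Variables (R : nzRingType) (P : set R).

Lemma sums0 : sums P 0.
Proof. by exists [::]; rewrite ?big_nil. Qed.

Lemma sums1 x : P x -> sums P x.
Proof.
by move=> Px; exists [:: x]; rewrite ?big_seq1// => y; rewrite inE => /eqP->.
Qed.

Lemma sumsD x y : sums P x -> sums P y -> sums P (x + y).
Proof.
move=> [s sP ->] [t tP ->]; exists (s ++ t); rewrite ?big_cat// => z.
by rewrite mem_cat => /orP[/sP|/tP].
Qed.

Lemma sums_sum (I : Type) (r : seq I) (Q : pred I) (c : I -> R) :
  (forall i, Q i -> sums P (c i)) -> sums P (\sum_(i <- r | Q i) c i).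
Proof.
by move=> cP; elim/big_ind: _ => //; [exact: sums0|exact: sumsD].
Qed.

End SumsTheory.

Section GradingTheory.
Variables (V : zmodType) (R : nzRingType) (gr : grading V R).

Lemma gpartN g x : gr g x -> gr g (- x).
Proof. by move=> gx; rewrite -sub0r; apply: gpartB => //; apply: gpart0. Qed.

Lemma gpartD g x y : gr g x -> gr g y -> gr g (x + y).
Proof. by move=> gx gy; rewrite -[y]opprK; apply/gpartB/gpartN. Qed.

Lemma gpart_sum g (I : Type) (r : seq I) (P : pred I) (c : I -> R) :
  (forall i, P i -> gr g (c i)) -> gr g (\sum_(i <- r | P i) c i).
Proof.
move=> gc; elim/big_ind: _ => //; first exact: gpart0.
exact: gpartD.
Qed.

Lemma gpart_disj g h x : gr g x -> gr h x -> x != 0 -> g = h.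
Proof.
move=> gx hx /eqP x0; apply: contrapT => /eqP ngh; apply: x0.
pose c k := if k == g then x else if k == h then - x else 0.
have := @gpart_free _ _ gr [:: g; h] c _ _ _ g; rewrite /c eqxx; apply.
- by rewrite /= inE ngh.
- move=> k; case: eqP => [->//|_]; case: eqP => [->|_]; first exact: gpartN.
  exact: gpart0.
- by rewrite big_cons big_seq1 /c /= eqxx (eq_sym h) (negPf ngh) eqxx subrr.
- by rewrite inE eqxx.
Qed.

Definition gdeg (x : R) : V := xget 0 [set g | gr g x].

Lemma gdegP x : homogeneous gr x -> gr (gdeg x) x.
Proof. by case=> g gx; rewrite /gdeg; case: xgetP => [|/(_ g)]; firstorder. Qed.

Lemma gpart_comp g x (s : seq R) :
  gr g x -> {in s, forall y, homogeneous gr y} -> x = \sum_(y <- s) y ->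
  x = \sum_(y <- s | gdeg y == g) y.
Proof.
move=> gx hs xE; pose t := undup (g :: map gdeg s).
pose c k := (\sum_(y <- s | gdeg y == k) y) - (if k == g then x else 0).
have ct : \sum_(k <- t) c k = 0.
  rewrite sumrB [X in _ - X](bigD1_seq g) ?undup_uniq ?mem_undup ?mem_head//= eqxx.
  rewrite [X in _ - (_ + X)]big1 => [|k /negPf->//]; rewrite addr0.
  have -> : \sum_(k <- t) \sum_(y <- s | gdeg y == k) y = x.
    rewrite (exchange_big_dep predT)//= xE big_seq [RHS]big_seq.
    apply: eq_bigr => y ys.
    rewrite big_mkcond (bigD1_seq (gdeg y)) ?undup_uniq//=.
      by rewrite eqxx big1 ?addr0// => k /negPf; rewrite eq_sym => ->.
    by rewrite mem_undup inE map_f ?orbT.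
  exact: subrr.
have gc k : gr k (c k).
  apply: gpartB; last by case: eqP => [->|_] //; apply: gpart0.
  rewrite big_seq_cond; apply: gpart_sum => y /andP[ys /eqP <-].
  exact/gdegP/hs.
have gt : g \in t by rewrite mem_undup mem_head.
have /eqP := gpart_free (undup_uniq _) gc ct gt.
by rewrite /c eqxx subr_eq0 => /eqP.
Qed.

End GradingTheory.

Section GradedDivision.
Variables (V : zmodType) (R : unitRingType) (gr : grading V R).

Lemma gpartV g x : gr g x -> x \is a GRing.unit -> gr (- g) x^-1.
Proof.
move=> gx xU; have [s hs sE] := gpart_span gr x^-1.
have h1 : 1 = \sum_(z <- [seq x * y | y <- s]) z.
  by rewrite big_map -mulr_sumr -sE divrr.
have hxs : {in [seq x * y | y <- s], forall z, homogeneous gr z}.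
  move=> _ /mapP[y /hs[h hy] ->]; exists (g + h); exact: gpartM.
have := gpart_comp (gpart1 gr) hxs h1; rewrite big_map -mulr_sumr.
move=> /(congr1 ( *%R x^-1)); rewrite mulr1 mulKr// => ->.
rewrite big_seq_cond; apply: gpart_sum => y /andP[ys /eqP d0].
have [->|y0] := eqVneq y 0; first exact: gpart0.
have [h hy] := hs _ ys.
have xy0 : x * y != 0 by rewrite -(mulr0 x) (inj_eq (mulrI xU)).
have <- // : h = - g.
apply: (addrI g); rewrite subrr.
apply: (@gpart_disj _ _ gr _ _ (x * y)) => //; first exact: gpartM.
by rewrite -d0; apply/gdegP/hxs/map_f.
Qed.

Hypothesis grD : gr_division gr.

Lemma supp_zmod_closed : GRing.zmod_closed [pred g | `[< supp gr g >]].
Proof.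
split=> [|g h]; rewrite !inE.
  by exists 1; [exact: gpart1|exact: oner_neq0].
move=> [x gx x0] [y hy y0].
have yU := grD hy y0; have xU := grD gx x0.
exists (x / y); first by apply: gpartM => //; apply: gpartV.
apply/eqP => xy0; have : x / y \is a GRing.unit by rewrite unitrMl ?unitrV.
by rewrite xy0 unitr0.
Qed.

End GradedDivision.

Structure gradedField (V : zmodType) := GradedField {
  gf_sort :> comUnitRingType;
  gf_gr : grading V gf_sort;
  gf_div : gr_division gf_gr
}.

(* Finite generation as a module expresses [D:F] < oo: graded modules over a
   graded field are free. *)
Structure gradedCDA (V : zmodType) (F : gradedField V) := GradedCDA {
  cda_sort :> unitAlgType F;
  cda_gr : grading V cda_sort;
  cda_div : gr_division cda_gr;
  cda_inj : injective (fun c : F => c%:A : cda_sort);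
  cda_grF : forall g (c : F), gf_gr F g c <-> cda_gr g c%:A;
  cda_center : forall z : cda_sort, (forall x, z * x = x * z) ->
    exists c : F, z = c%:A;
  cda_fin : exists (n : nat) (b : 'I_n -> cda_sort), forall x,
    exists c : 'I_n -> F, x = \sum_i c i *: b i
}.

Section FactorSet.
Variables (V : zmodType) (A : unitRingType) (gr : grading V A).

Definition gr_ideal (I : set A) : Prop :=
  [/\ I 0, forall x y, I x -> I y -> I (x + y),
      forall a x, I x -> I (a * x) /\ I (x * a) &
      I `<=` sums [set y | homogeneous gr y /\ I y]].

(* The base graded field is represented by its image L, the centre of A. *)
Record gr_central_simple (L : set A) : Prop := GrCentralSimple {
  gcs_center : forall z, L z <-> forall x, z * x = x * z;
  gcs_graded : L `<=` sums [set y | homogeneous gr y /\ L y];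
  gcs_field : forall z, L z -> homogeneous gr z -> z != 0 ->
    exists2 y, L y & z * y = 1;
  gcs_fin : exists (n : nat) (b : 'I_n -> A), forall x,
    exists2 c : 'I_n -> A, (forall i, L (c i)) & x = \sum_i c i * b i;
  gcs_simple : forall I, gr_ideal I -> I = [set 0] \/ I = setT
}.

Variables (L : set A) (H : finGroupType) (act : H -> A -> A).

(* H acts on L by graded ring automorphisms; the values of act outside L are
   irrelevant. *)
Record gr_action : Prop := GrAction {
  gra_stable : forall s z, L z -> L (act s z);
  gra1 : forall z, L z -> act 1%g z = z;
  graM : forall s t z, L z -> act (s * t)%g z = act s (act t z);
  gra_add : forall s y z, L y -> L z -> act s (y + z) = act s y + act s z;
  gra_mul : forall s y z, L y -> L z -> act s (y * z) = act s y * act s z;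
  gra_one : forall s, act s 1 = 1;
  gra_gr : forall s g z, L z -> gr g z -> gr g (act s z)
}.

(* The first two fields are the standing assumptions on A, L and H. *)
Record gr_factor_set := GrFactorSet {
  fs_csa : gr_central_simple L;
  fs_act : gr_action;
  fs_w : H -> {rmorphism A -> A};
  fs_f : H -> H -> A;
  fs_w_bij : forall s, bijective (fs_w s);
  fs_w_gr : forall s g a, gr g a -> gr g (fs_w s a);
  fs_unit : forall s t, fs_f s t \is a GRing.unit;
  fs_w_act : forall s z, L z -> fs_w s z = act s z;
  fs_w_comp : forall s t a,
    fs_w s (fs_w t a) = fs_f s t * fs_w (s * t)%g a * (fs_f s t)^-1;
  fs_cocycle : forall s t u,
    fs_f s t * fs_f (s * t)%g u = fs_w s (fs_f t u) * fs_f s (t * u)%g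
}.

End FactorSet.

Section CrossedProduct.
Variables (V : zmodType) (A : unitRingType) (gr : grading V A) (L : set A).
Variables (H : finGroupType) (act : H -> A -> A).

(* u : crossed fs stands for \sum_s u s x_s; fs determines the product *)
Definition crossed (fs : gr_factor_set gr L act) : Type := {ffun H -> A}.

Variable fs : gr_factor_set gr L act.
Local Notation w := (fs_w fs).
Local Notation f := (fs_f fs).
Local Notation C := (crossed fs).

HB.instance Definition _ := GRing.Zmodule.on C.

Implicit Types u v : C.

(* a x_s *)
Definition cpmono (a : A) (s : H) : C :=
  [ffun r => if r == s then a else 0].

(* (a x_s) (b x_t) = a w_s(b) f(s,t) x_(st), extended biadditively *)
Definition cpmul u v : C :=
  \sum_s \sum_t cpmono (u s * w s (v t) * f s t) (s * t)%g.

(* the unit element of A is f(1,1)^-1 x_1 *)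
Definition cpone : C := cpmono (f 1%g 1%g)^-1 1%g.

Lemma cpmonoD a b s : cpmono (a + b) s = cpmono a s + cpmono b s.
Proof. by apply/ffunP => r; rewrite !ffunE; case: eqP; rewrite ?addr0. Qed.

Lemma cpmono0 s : cpmono 0 s = 0.
Proof. by apply/ffunP => r; rewrite !ffunE; case: eqP. Qed.

Lemma cpmono_sumE u : u = \sum_s cpmono (u s) s.
Proof.
apply/ffunP => r; rewrite sum_ffunE (bigD1 r)//= ffunE eqxx big1 ?addr0//.
by move=> s /negPf; rewrite ffunE eq_sym => ->.
Qed.

Lemma cpmulDl : left_distributive cpmul +%R.
Proof.
move=> u v t; rewrite /cpmul -big_split; apply: eq_bigr => s _ /=.
by rewrite -big_split; apply: eq_bigr => r _; rewrite ffunE !mulrDl cpmonoD.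
Qed.

Lemma cpmulDr : right_distributive cpmul +%R.
Proof.
move=> u v t; rewrite /cpmul -big_split; apply: eq_bigr => s _ /=.
rewrite -big_split; apply: eq_bigr => r _.
by rewrite ffunE rmorphD mulrDr mulrDl cpmonoD.
Qed.

Lemma cpmul0l u : cpmul 0 u = 0.
Proof. by apply: (addrI (cpmul 0 u)); rewrite -cpmulDl !addr0. Qed.

Lemma cpmul0r u : cpmul u 0 = 0.
Proof. by apply: (addrI (cpmul u 0)); rewrite -cpmulDr !addr0. Qed.

Lemma cpmul_suml (I : Type) (r : seq I) (c : I -> C) u :
  cpmul (\sum_(i <- r) c i) u = \sum_(i <- r) cpmul (c i) u.
Proof. exact: (big_morph (cpmul^~ u) (fun x y => cpmulDl x y u) (cpmul0l u)). Qed.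

Lemma cpmul_sumr (I : Type) (r : seq I) (c : I -> C) u :
  cpmul u (\sum_(i <- r) c i) = \sum_(i <- r) cpmul u (c i).
Proof. exact: (big_morph (cpmul u) (cpmulDr u) (cpmul0r u)). Qed.

Lemma cpmul_mono a s b t :
  cpmul (cpmono a s) (cpmono b t) = cpmono (a * w s b * f s t) (s * t)%g.
Proof.
rewrite /cpmul (bigD1 s)//= (bigD1 t)//= !ffunE !eqxx !big1 ?addr0//.
  move=> r /negPf rs; rewrite big1// => q _.
  by rewrite [cpmono a s r]ffunE rs !mul0r cpmono0.
by move=> r /negPf rt; rewrite !ffunE rt rmorph0 mulr0 mul0r cpmono0.
Qed.

Lemma cpmulA : associative cpmul.
Proof.
move=> u v z; rewrite {1 2}(cpmono_sumE u) (cpmul_suml _ _ (cpmul v z)).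
rewrite (cpmul_suml _ _ v) (cpmul_suml _ _ z); apply: eq_bigr => r _.
rewrite {1 2}(cpmono_sumE v) (cpmul_suml _ _ z).
rewrite !(cpmul_sumr _ _ (cpmono (u r) r)) (cpmul_suml _ _ z).
apply: eq_bigr => q _; rewrite {1 2}(cpmono_sumE z).
rewrite (cpmul_sumr _ _ (cpmono (v q) q)) (cpmul_sumr _ _ (cpmono (u r) r)).
rewrite [in RHS]cpmul_mono (cpmul_sumr _ _ (cpmono _ (r * q)%g)).
apply: eq_bigr => p _; rewrite !cpmul_mono mulgA; congr (cpmono _ _).
rewrite !rmorphM fs_w_comp -!mulrA; congr (_ * (_ * (_ * (_ * _)))).
by rewrite -fs_cocycle mulKr ?fs_unit.
Qed.

Lemma fs_w1 a : w 1%g a = f 1%g 1%g * a * (f 1%g 1%g)^-1.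
Proof.
have [w' _ wK] := fs_w_bij fs 1%g.
by rewrite -{1}(wK a) fs_w_comp mul1g wK.
Qed.

Lemma fs_f1l s : f 1%g s = f 1%g 1%g.
Proof.
have := fs_cocycle fs 1%g 1%g s; rewrite !mul1g fs_w1 -!mulrA.
move=> /(mulrI (fs_unit fs _ _)); rewrite -{1}[f 1%g s]mulr1.
move=> /(mulrI (fs_unit fs _ _)) /(congr1 ( *%R (f 1%g 1%g))).
by rewrite mulr1 mulVKr// fs_unit.
Qed.

Lemma fs_f1r s : f s 1%g = w s (f 1%g 1%g).
Proof.
have := fs_cocycle fs s 1%g 1%g; rewrite !mulg1.
exact: (mulIr (fs_unit fs _ _)).
Qed.

Lemma cpmul1l : left_id cpone cpmul.
Proof.
move=> u; rewrite {2}(cpmono_sumE u) {1}(cpmono_sumE u) cpmul_sumr.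
apply: eq_bigr => s _; rewrite cpmul_mono mul1g fs_w1 fs_f1l.
by rewrite -!mulrA mulVr ?fs_unit// mulr1 mulKr ?fs_unit.
Qed.

Lemma cpmul1r : right_id cpone cpmul.
Proof.
move=> u; rewrite {2}(cpmono_sumE u) {1}(cpmono_sumE u) cpmul_suml.
apply: eq_bigr => s _; rewrite cpmul_mono mulg1 (fs_f1r s).
by rewrite -mulrA -rmorphM mulVr ?fs_unit// rmorph1 mulr1.
Qed.

Lemma cpone_neq0 : cpone != 0.
Proof.
apply/eqP => /ffunP/(_ 1%g); rewrite !ffunE eqxx => f0.
have : (f 1%g 1%g)^-1 \is a GRing.unit by rewrite unitrV fs_unit.
by rewrite f0 unitr0.
Qed.

HB.instance Definition _ := GRing.Zmodule_isNzRing.Build C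
  cpmulA cpmul1l cpmul1r cpmulDl cpmulDr cpone_neq0.

Definition cpx (s : H) : C := cpmono 1 s.

Definition cpincl (a : A) : C := cpmono (a * (f 1%g 1%g)^-1) 1%g.

Lemma cpincl_zmod_morphism : zmod_morphism cpincl.
Proof.
by move=> a b; rewrite /cpincl mulrBl; apply/ffunP => r; rewrite !ffunE;
   case: eqP; rewrite ?subr0.
Qed.

Lemma cpincl_monoid_morphism : monoid_morphism cpincl.
Proof.
split=> [|a b]; first by rewrite /cpincl mul1r.
rewrite /cpincl [RHS]cpmul_mono mul1g fs_w1; congr (cpmono _ _).
rewrite -!mulrA mulVr ?fs_unit// mulr1; congr (_ * _).
by rewrite mulKr ?fs_unit.
Qed.

HB.instance Definition _ :=
  GRing.isZmodMorphism.Build A C cpincl cpincl_zmod_morphism.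
HB.instance Definition _ :=
  GRing.isMonoidMorphism.Build A C cpincl cpincl_monoid_morphism.

Lemma cpincl_cpx a s : cpincl a * cpx s = cpmono a s.
Proof.
rewrite [LHS]cpmul_mono mul1g rmorph1 mulr1 fs_f1l.
by rewrite -mulrA mulVr ?fs_unit// mulr1.
Qed.

Lemma cp_basis u : u = \sum_s cpincl (u s) * cpx s.
Proof.
by rewrite {1}(cpmono_sumE u); apply: eq_bigr => s _; rewrite cpincl_cpx.
Qed.

Lemma cpx_incl s a : cpx s * cpincl a = cpincl (w s a) * cpx s.
Proof.
rewrite cpincl_cpx [LHS]cpmul_mono mulg1 mul1r (fs_f1r s) rmorphM -mulrA.
by rewrite -rmorphM mulVr ?fs_unit// rmorph1 mulr1.
Qed.

Lemma cpxM s t : cpx s * cpx t = cpincl (f s t) * cpx (s * t)%g.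
Proof. by rewrite cpincl_cpx [LHS]cpmul_mono rmorph1 !mul1r. Qed.

Definition crossed_grading (grC : grading V C) : Prop :=
  (forall g a, gr g a <-> grC g (cpincl a)) /\
  (forall s, homogeneous grC (cpx s)).

End CrossedProduct.

Section DivisionAlgebra.
Variables (V : zmodType) (F : gradedField V) (D : gradedCDA F).
Local Notation gF := (gf_gr F).
Local Notation gD := (cda_gr D).

Definition degD : pred V := [pred g | `[< supp gD g >]].
HB.instance Definition _ :=
  GRing.isZmodClosed.Build V degD (supp_zmod_closed (@cda_div V F D)).

Definition GammaD : Type := {g : V | degD g}.
HB.instance Definition _ := SubChoice.on GammaD.
HB.instance Definition _ := [SubChoice_isSubZmodule of GammaD by <:].

Definition degF : pred GammaD := [pred g | `[< supp gF (val g) >]].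

Lemma degF_zmod_closed : GRing.zmod_closed degF.
Proof.
have [h0 hB] := supp_zmod_closed (@gf_div V F).
split=> [|g h]; first exact: h0.
exact: hB.
Qed.
HB.instance Definition _ :=
  GRing.isZmodClosed.Build GammaD degF degF_zmod_closed.

Definition degFz : zmodClosed GammaD := GRing.ZmodClosed.clone _ degF _.

Definition GammaDF : Type := (Quotient.quot degFz).
HB.instance Definition _ := GRing.Zmodule.on GammaDF.

Definition degcl (g : GammaD) : GammaDF := \pi_(Quotient.quot degFz) g.

Lemma degclP g h : degcl g = degcl h <-> supp gF (val g - val h).
Proof.
split=> [/eqP|gh]; first by rewrite -Quotient.idealrBE => /asboolP.
by apply/eqP; rewrite -Quotient.idealrBE; apply/asboolP.
Qed.

Definition degrepr (s : GammaDF) : GammaD :=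
  generic_quotient.repr (s : Quotient.quot degFz).

Lemma degreprK : cancel degrepr degcl.
Proof. exact: reprK. Qed.

Lemma gpartZ g h (c : F) (x : D) : gF g c -> gD h x -> gD (g + h) (c *: x).
Proof. by move=> /cda_grF gc hx; rewrite -mulr_algl; apply: gpartM. Qed.

Lemma cda_gen : exists T : seq D, {in T, forall y, homogeneous gD y} /\
  forall x, sums [set z | exists e y,
    [/\ homogeneous gF e, y \in T & z = e *: y]] x.
Proof.
have [n [b bP]] := cda_fin D.
have /choice[B BP] : forall i, exists s : seq D,
    {in s, forall y, homogeneous gD y} /\ b i = \sum_(y <- s) y.
  by move=> i; have [s sP sE] := gpart_span gD (b i); exists s.
exists (flatten [seq B i | i <- enum 'I_n]); split.
  by move=> y /flatten_mapP[i _ yB]; apply: (BP i).1.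
move=> x; have [c ->] := bP x; apply: sums_sum => i _.
rewrite (BP i).2 scaler_sumr big_seq; apply: sums_sum => y yB.
have [t tP ->] := gpart_span gF (c i).
rewrite scaler_suml big_seq; apply: sums_sum => e et.
apply: sums1; exists e, y; split=> //; first exact: tP.
by apply/flatten_mapP; exists i => //; rewrite mem_enum.
Qed.

Lemma GammaDF_fin : exists s : seq GammaDF, forall g, g \in s.
Proof.
have [T [hT genT]] := cda_gen.
exists [seq degcl (insubd 0 (gdeg gD y)) | y <- T] => s.
have := valP (degrepr s) => /asboolP; rewrite /supp/= => -[x gx x0].
have [r rP rE] := genT x.
have hr : {in r, forall z, homogeneous gD z}.
  move=> _ /rP[e [y [[g ge] yT ->]]]; have [h hy] := hT _ yT.
  by exists (g + h); apply: gpartZ.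
have [z zr /andP[/eqP gz z0]] :
    exists2 z, z \in r & (gdeg gD z == val (degrepr s)) && (z != 0).
  apply/hasP; apply: contraNT x0 => /hasPn h0.
  rewrite (gpart_comp gx hr rE) big_seq_cond big1// => z /andP[zr zg].
  by have := h0 _ zr; rewrite zg/= negbK => /eqP.
have [e [y [[g ge] yT zE]]] := rP _ zr.
have [h hy] := hT _ yT.
have e0 : e != 0 by apply: contraNneq z0 => e0; rewrite zE e0 scale0r.
have y0 : y != 0 by apply: contraNneq z0 => y0; rewrite zE y0 scaler0.
have yh : gdeg gD y = h by apply: (gpart_disj (gdegP (hT _ yT)) hy).
have dh : degD h by apply/asboolP; exists y.
apply/mapP; exists y => //; rewrite yh -[LHS]degreprK; apply/degclP.
rewrite insubdK//; exists e => //; suff -> : val (degrepr s) - h = g by [].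
apply/eqP; rewrite subr_eq -gz; apply/eqP.
apply: (gpart_disj (gdegP (hr _ zr)) _ z0).
by rewrite zE; apply: gpartZ.
Qed.

Definition GammaDF_enum : seq GammaDF := undup (sval (cid GammaDF_fin)).

Lemma mem_GammaDF_enum g : g \in GammaDF_enum.
Proof. by rewrite mem_undup; apply: (svalP (cid GammaDF_fin)). Qed.

Lemma GammaDF_pcan : pcancel (index^~ GammaDF_enum) (onth GammaDF_enum).
Proof.
move=> g; have gE := mem_GammaDF_enum g.
by rewrite onthE (nth_map g) ?index_mem// nth_index.
Qed.

HB.instance Definition _ := Choice_isCountable.Build GammaDF GammaDF_pcan.

Lemma GammaDF_enumP : Finite.axiom GammaDF_enum.
Proof.
by move=> g; rewrite count_uniq_mem ?undup_uniq// mem_GammaDF_enum.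
Qed.
HB.instance Definition _ := isFinite.Build GammaDF GammaDF_enumP.
(* From here on (s * t)%g on GammaDF is s + t. *)
HB.instance Definition _ := [finGroupMixin of GammaDF for +%R].

(* An F-subalgebra contains the image of F, so this is the subalgebra generated
   by S and F. *)
Definition subalg_gen (S : set D) : set D :=
  smallest [set T : set D | GRing.subalg_closed (fun x : D => x \in T)] S.

Lemma subalg_gen_closed (S : set D) :
  GRing.subalg_closed (fun x : D => x \in subalg_gen S).
Proof.
split=> [|c x y|x y]; rewrite !unfold_in.
- by apply/mem_set => T [[]] + _ _ _ => /set_mem.
- move=> /set_mem xS /set_mem yS; apply/mem_set => T TS.
  have [[_ TL _] _] := TS.
  by apply/set_mem/(TL c x y); apply/mem_set; [apply: xS|apply: yS].
- move=> /set_mem xS /set_mem yS; apply/mem_set => T TS.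
  have [[_ _ TM] _] := TS.
  by apply/set_mem/(TM x y); apply/mem_set; [apply: xS|apply: yS].
Qed.

Lemma subalg_gen_sub (S T : set D) :
  T 1 -> (forall (c : F) x y, T x -> T y -> T (c *: x + y)) ->
  (forall x y, T x -> T y -> T (x * y)) -> S `<=` T -> subalg_gen S `<=` T.
Proof.
move=> T1 TL TM; apply: smallest_sub; split=> [|c x y|x y]; rewrite ?unfold_in.
- exact/mem_set.
- by move=> /set_mem xT /set_mem yT; apply/mem_set/TL.
- by move=> /set_mem xT /set_mem yT; apply/mem_set/TM.
Qed.

Definition D0Fpred : pred D := fun x => x \in subalg_gen (gD 0).
HB.instance Definition _ := GRing.isSubringClosed.Build D D0Fpred
  (GRing.subalg_closedBM (subalg_gen_closed (gD 0))).

Definition D0F : Type := {x : D | D0Fpred x}.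
HB.instance Definition _ := SubChoice.on D0F.
HB.instance Definition _ := [SubChoice_isSubNzRing of D0F by <:].


(* Units of D0F are the elements with a two-sided inverse in D0F itself, not
   merely in D. *)
Definition D0F_unit : pred D0F :=
  [pred a | `[< exists b : D0F, b * a = 1 /\ a * b = 1 >]].

Definition D0F_inv (a : D0F) : D0F :=
  if pselect (exists b : D0F, b * a = 1 /\ a * b = 1) is left h
  then sval (cid h) else a.

Lemma D0F_mulVr : {in D0F_unit, left_inverse 1 D0F_inv *%R}.
Proof.
move=> a /asboolP ha; rewrite /D0F_inv; case: pselect => // h.
exact: (svalP (cid h)).1.
Qed.

Lemma D0F_divrr : {in D0F_unit, right_inverse 1 D0F_inv *%R}.
Proof.
move=> a /asboolP ha; rewrite /D0F_inv; case: pselect => // h.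
exact: (svalP (cid h)).2.
Qed.

Lemma D0F_unitrP (a b : D0F) : b * a = 1 /\ a * b = 1 -> D0F_unit a.
Proof. by move=> h; apply/asboolP; exists b. Qed.

Lemma D0F_invr_out : {in [predC D0F_unit], D0F_inv =1 id}.
Proof.
by move=> a /asboolPn ha; rewrite /D0F_inv; case: pselect.
Qed.

HB.instance Definition _ := GRing.NzRing_hasMulInverse.Build D0F
  D0F_mulVr D0F_divrr D0F_unitrP D0F_invr_out.

Lemma D0FP (x : D) : D0Fpred x <-> subalg_gen (gD 0) x.
Proof. by split=> [/set_mem|/mem_set]. Qed.

Lemma D0_D0F (x : D) : gD 0 x -> D0Fpred x.
Proof. by move=> x0; apply/mem_set; apply: sub_gen_smallest. Qed.

Lemma D0F_linear (c : F) (x y : D) :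
  D0Fpred x -> D0Fpred y -> D0Fpred (c *: x + y).
Proof. by have [_ + _] := subalg_gen_closed (gD 0) => /(_ c x y). Qed.

Lemma D0F_scale (c : F) (x : D) : D0Fpred x -> D0Fpred (c *: x).
Proof.
by move=> xA; rewrite -[_ *: _]addr0; apply: D0F_linear => //; apply: rpred0.
Qed.

Lemma D0F_ind (T : set D) :
  T 1 -> (forall (c : F) x y, T x -> T y -> T (c *: x + y)) ->
  (forall x y, T x -> T y -> T (x * y)) -> gD 0 `<=` T ->
  forall x, D0Fpred x -> T x.
Proof. by move=> T1 TL TM T0 x /D0FP; apply: subalg_gen_sub. Qed.

Definition D0F_part (g : V) : set D0F := [set a | gD g (val a)].

Lemma D0F_span (a : D0F) : sums [set b | exists g, D0F_part g b] a.
Proof.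
have : sums [set x | homogeneous gD x /\ D0Fpred x] (val a).
  apply: D0F_ind (valP a) => [|c x y [r rP rE] hy|x y [r rP ->] [s sP ->]|x x0].
  - apply: sums1; split; first by exists 0; apply: gpart1.
    exact: rpred1.
  - apply: sumsD hy; rewrite rE scaler_sumr big_seq; apply: sums_sum => z zr.
    have [t tP ->] := gpart_span gF c; rewrite scaler_suml big_seq.
    apply: sums_sum => e et; apply: sums1; have [[h hz] zA] := rP _ zr.
    have [g ge] := tP _ et; split; last exact: D0F_scale.
    by exists (g + h); apply: gpartZ.
  - rewrite mulr_suml big_seq; apply: sums_sum => z zr.
    rewrite mulr_sumr big_seq; apply: sums_sum => u us; apply: sums1.
    have [[g gz] zA] := rP _ zr; have [[h hu] uA] := sP _ us.
    by split; [exists (g + h); apply: gpartM|apply: rpredM].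
  - by apply: sums1; split; [exists 0|apply: D0_D0F].
move=> [s sP sE]; exists [seq insubd 0 x | x <- s].
  move=> _ /mapP[x /sP[[g gx] xA] ->]; exists g.
  by rewrite /D0F_part/= insubdK.
apply: val_inj; rewrite sE raddf_sum big_map big_seq [RHS]big_seq.
by apply: eq_bigr => x /sP[_ xA]; rewrite /= insubdK.
Qed.

Lemma D0F_free (s : seq V) (c : V -> D0F) : uniq s ->
  (forall g, D0F_part g (c g)) -> \sum_(g <- s) c g = 0 ->
  {in s, forall g, c g = 0}.
Proof.
move=> us cP /(congr1 val); rewrite raddf_sum => s0 g gs.
by apply: val_inj; apply: (gpart_free us cP s0).
Qed.

Definition D0F_gr : grading V D0F := @Grading V D0F D0F_part
  (fun g => gpart0 gD g)
  (fun g (x y : D0F) => @gpartB _ _ gD g (val x) (val y))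
  (gpart1 gD)
  (fun g h (x y : D0F) => @gpartM _ _ gD g h (val x) (val y))
  D0F_span D0F_free.

Definition ZD0 : set D :=
  [set x | gD 0 x /\ forall y, gD 0 y -> x * y = y * x].
Definition ZD0F : set D0F := [set a | subalg_gen ZD0 (val a)].

Lemma degrep_ex (s : GammaDF) : exists x : D, gD (val (degrepr s)) x /\ x != 0.
Proof. by have /asboolP[x gx x0] := valP (degrepr s); exists x. Qed.

Definition degrep (s : GammaDF) : D := sval (cid (degrep_ex s)).

Lemma gpart_degrep s : gD (val (degrepr s)) (degrep s).
Proof. exact: (svalP (cid (degrep_ex s))).1. Qed.

Lemma degrep_unit s : degrep s \is a GRing.unit.
Proof.
exact: cda_div (gpart_degrep s) (svalP (cid (degrep_ex s))).2.
Qed.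

Lemma D0F_conj g (x : D) (a : D0F) : gD g x -> x \is a GRing.unit ->
  D0Fpred (x * val a * x^-1).
Proof.
move=> gx xU; apply: (@D0F_ind [set y | D0Fpred (x * y * x^-1)]) (valP a).
- by rewrite /= mulr1 divrr//; apply: rpred1.
- move=> c y z hy hz /=; rewrite mulrDr mulrDl -scalerAr -scalerAl.
  exact: D0F_linear.
- move=> y z hy hz /=.
  have -> : x * (y * z) * x^-1 = (x * y * x^-1) * (x * z * x^-1).
    by rewrite -!mulrA mulKr.
  exact: rpredM.
- move=> y y0 /=; apply: D0_D0F.
  have <- : g + 0 + - g = 0 by rewrite addr0 subrr.
  by apply: gpartM; [apply: gpartM|apply: gpartV].
Qed.

Definition D0F_act (s : GammaDF) (a : D0F) : D0F :=
  Sub (degrep s * val a * (degrep s)^-1)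
    (D0F_conj a (gpart_degrep s) (degrep_unit s)).

Lemma ZD0F_comm (a : D0F) (d : D) : ZD0F a -> gD 0 d -> val a * d = d * val a.
Proof.
move=> aZ d0.
apply: (@subalg_gen_sub ZD0 [set z | z * d = d * z]) (val a) aZ => /=.
- by rewrite mul1r mulr1.
- by move=> c y z hy hz; rewrite mulrDl mulrDr -scalerAl -scalerAr hy hz.
- by move=> y z hy hz; rewrite -mulrA hz !mulrA hy.
- by move=> z [_]; apply.
Qed.

(* On Z(D_0)F the choice of representatives in D0F_act is immaterial. *)
Lemma D0F_actE (g : GammaD) (x : D) (a : D0F) :
  gD (val g) x -> x != 0 -> ZD0F a ->
  val (D0F_act (degcl g) a) = x * val a * x^-1.
Proof.
move=> gx x0 aZ; rewrite /=; set u := degrep _.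
have uU : u \is a GRing.unit := degrep_unit _.
have xU := cda_div gx x0.
have [c hc c0] : supp gF (val (degrepr (degcl g)) - val g).
  by apply/degclP; rewrite degreprK.
have cU := gf_div hc c0; set h := val _ - _ in hc.
pose d := x^-1 * (c^-1 *: u).
have d0 : gD 0 d.
  have <- : - val g + (- h + val (degrepr (degcl g))) = 0.
    by rewrite /h opprB addrNK addNr.
  apply: gpartM; first exact: gpartV.
  by apply: gpartZ; [apply: gpartV|apply: gpart_degrep].
have uE : u = c *: (x * d) by rewrite mulVKr// scalerA divrr// scale1r.
move: d d0 uE => d d0 uE; apply: (mulIr uU); rewrite mulrVK// uE -scalerAl -scalerAr; congr (_ *: _).
rewrite -!mulrA; congr (_ * _); rewrite mulKr//.
exact/esym/ZD0F_comm.
Qed.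

End DivisionAlgebra.

(* Main.v *)
Require Import Defs.
From HB Require Import structures.
From mathcomp Require Import all_boot all_order all_fingroup all_algebra.
From mathcomp Require Import boolp classical_sets.

Set Implicit Arguments.
Unset Strict Implicit.
Unset Printing Implicit Defensive.

Import GRing.Theory.
Local Open Scope ring_scope.

(** Write [DF] for the sum of the parts of [D] whose degree lies in the support
    of [F]. A nonzero scalar in [F_g] is invertible and carries [D_0] onto
    [D_g], so [DF] is exactly the subalgebra [D_0 F] ([D0F_homog], [D0F_sums]).
    Everything follows from this description by comparing degrees.

    The algebra [D_0 F] is graded central simple. Its nonzero homogeneous
    elements are units of [D_0 F], since their inverses again have degree in the
    support of [F], so there are no proper graded ideals. A central element has
    central components, each a scalar times an element of [D_0] that commutes
    with [D_0]; hence the centre is [Z(D_0) F] ([ZD0F_center]). Homogeneous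
    generators of [D] over [F] with degree in the support of [F] generate
    [D_0 F] ([D0F_gen]), which gives finiteness.

    For the factor set, choose a homogeneous unit [x_s] in each class [s] of
    degrees modulo the support of [F]; put [w_s = Inn(x_s)] and
    [f(s,t) = x_s x_t x_(st)^-1]. The degree of [f(s,t)] lies in the support of
    [F], so [f(s,t)] is in [D_0 F], and the identities of a factor set are
    cancellations in [D].

    The isomorphism sends [sum_s u_s x_s] to the same sum computed in [D]. It is
    injective because the components of [u_s x_s] have their degrees in the
    coset [s] ([crossed_eval_inj]), and surjective because a homogeneous element
    of degree in [s] divided by [x_s] lies in [D_0 F] ([crossed_eval_surj]). The
    grading of the crossed product is the one of [D], pulled back. *)

(** * Homogeneous components *)

Section Components.
Variables (V : zmodType) (R : nzRingType) (gr : grading V R).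
Implicit Types (g h : V) (x y : R).

Lemma gdegN x : gdeg gr (- x) = gdeg gr x.
Proof.
rewrite /gdeg; congr (xget 0 _); apply/funext => g; apply/propext; split.
  by move=> /(@gpartN _ _ gr); rewrite opprK.
exact: gpartN.
Qed.

Definition homog_terms x : seq R := sval (cid2 (gpart_span gr x)).

Lemma homog_termsP x : {in homog_terms x, forall y, homogeneous gr y}.
Proof. by rewrite /homog_terms; case: cid2. Qed.

Lemma homog_terms_sum x : x = \sum_(y <- homog_terms x) y.
Proof. by rewrite /homog_terms; case: cid2. Qed.

Definition gcomp g x : R := \sum_(y <- homog_terms x | gdeg gr y == g) y.

(** Subtracting two homogeneous decompositions of the same element gives a
    decomposition of 0, whose part of degree [g] vanishes; so the component does
    not depend on the decomposition chosen. *)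
Lemma gcomp_sumE g (t : seq R) : {in t, forall y, homogeneous gr y} ->
  gcomp g (\sum_(y <- t) y) = \sum_(y <- t | gdeg gr y == g) y.
Proof.
move=> ht; set x := \sum_(y <- t) y.
have h0 : 0 = \sum_(y <- homog_terms x ++ [seq - y | y <- t]) y.
  by rewrite big_cat /= big_map sumrN -homog_terms_sum subrr.
have hst : {in homog_terms x ++ [seq - y | y <- t],
    forall y, homogeneous gr y}.
  move=> y; rewrite mem_cat => /orP[/homog_termsP//|/mapP[z /ht[h hz] ->]].
  by exists h; apply: gpartN.
have := gpart_comp (gpart0 gr g) hst h0; rewrite big_cat /= big_map sumrN.
under [X in _ - X]eq_bigl => y do rewrite gdegN.
by move=> /eqP; rewrite eq_sym subr_eq0 => /eqP.
Qed.

Lemma gcompD g x y : gcomp g (x + y) = gcomp g x + gcomp g y.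
Proof.
rewrite {1}(homog_terms_sum x) {1}(homog_terms_sum y) -big_cat gcomp_sumE.
  by rewrite big_cat.
by move=> z; rewrite mem_cat => /orP[] /homog_termsP.
Qed.

Lemma gcomp0 g : gcomp g 0 = 0.
Proof. by apply: (addrI (gcomp g 0)); rewrite -gcompD !addr0. Qed.

Lemma gcomp_sum g (I : Type) (r : seq I) (P : pred I) (c : I -> R) :
  gcomp g (\sum_(i <- r | P i) c i) = \sum_(i <- r | P i) gcomp g (c i).
Proof. exact: (big_morph (gcomp g) (gcompD g) (gcomp0 g)). Qed.

Lemma gcomp_gpart g x : gr g (gcomp g x).
Proof.
rewrite /gcomp big_seq_cond; apply: gpart_sum => y /andP[/homog_termsP hy].
by move=> /eqP <-; apply: gdegP.
Qed.

Lemma gcomp_homog g h x : gr h x -> gcomp g x = if g == h then x else 0.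
Proof.
move=> hx; have [->|x0] := eqVneq x 0; first by rewrite gcomp0 if_same.
have hg : homogeneous gr x by exists h.
have := @gcomp_sumE g [:: x]; rewrite big_seq1 big_mkcond big_seq1 => ->.
  by rewrite (gpart_disj (gdegP hg) hx x0) eq_sym.
by move=> y; rewrite inE => /eqP ->.
Qed.

Lemma gcomp_span x : exists s : seq V, x = \sum_(g <- s) gcomp g x.
Proof.
exists (undup (map (gdeg gr) (homog_terms x))).
rewrite {1}(homog_terms_sum x) /gcomp (exchange_big_dep predT)//=.
rewrite big_seq [RHS]big_seq; apply: eq_bigr => y ys.
rewrite big_mkcond (bigD1_seq (gdeg gr y)) ?undup_uniq ?mem_undup ?map_f//=.
by rewrite eqxx big1 ?addr0// => k /negPf; rewrite eq_sym => ->.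
Qed.

Lemma gcomp_eq0 x : (forall g, gcomp g x = 0) -> x = 0.
Proof. by move=> x0; have [s ->] := gcomp_span x; rewrite big1. Qed.

Lemma gcompMr g x d : gr 0 d -> gcomp g (x * d) = gcomp g x * d.
Proof.
move=> d0; have [s xE] := gcomp_span x.
rewrite [in LHS]xE [in RHS]xE mulr_suml !gcomp_sum mulr_suml.
apply: eq_bigr => h _; have hx := gcomp_gpart h x.
have := gpartM hx d0; rewrite addr0 => hxd.
by rewrite (gcomp_homog _ hx) (gcomp_homog _ hxd); case: eqP; rewrite ?mul0r.
Qed.

Lemma gcompMl g x d : gr 0 d -> gcomp g (d * x) = d * gcomp g x.
Proof.
move=> d0; have [s xE] := gcomp_span x.
rewrite [in LHS]xE [in RHS]xE mulr_sumr !gcomp_sum mulr_sumr.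
apply: eq_bigr => h _; have hx := gcomp_gpart h x.
have := gpartM d0 hx; rewrite add0r => hxd.
by rewrite (gcomp_homog _ hx) (gcomp_homog _ hxd); case: eqP; rewrite ?mulr0.
Qed.

End Components.

Lemma sums_sub (R : nzRingType) (P Q : set R) (x : R) :
  Q 0 -> (forall y z, Q y -> Q z -> Q (y + z)) -> (forall y, P y -> Q y) ->
  sums P x -> Q x.
Proof.
move=> Q0 QD PQ [s sP ->]; rewrite big_seq.
by elim/big_ind: _ => // y /sP /PQ.
Qed.

Lemma unit_neq0 (R : unitRingType) (x : R) : x \is a GRing.unit -> x != 0.
Proof. by apply: contraTneq => ->; rewrite unitr0. Qed.

Section CrossedProductStructure.
Variables (V : zmodType) (F : gradedField V) (D : gradedCDA F).
Local Notation gF := (gf_gr F).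
Local Notation gD := (cda_gr D).
Local Notation A := (D0F D).
Local Notation gA := (D0F_gr D).
Local Notation Z := (@ZD0F V F D).
Local Notation G := (GammaDF D).
Local Notation act := (@D0F_act V F D).
Local Notation xs := (@degrep V F D).

Implicit Types (g h : V) (x y : D) (a b : A) (s t : G).

(** * The algebra generated by the degree zero part and the base *)

Lemma suppF0 : supp gF 0.
Proof. by have [h0 _] := supp_zmod_closed (@gf_div V F); rewrite inE in h0. Qed.

Lemma suppFB g h : supp gF g -> supp gF h -> supp gF (g - h).
Proof.
move=> hg hh; have [_ /(_ g h)] := supp_zmod_closed (@gf_div V F).
by rewrite !inE; apply.
Qed.

Lemma suppFN g : supp gF g -> supp gF (- g).
Proof. by move=> hg; rewrite -sub0r; apply/suppFB/hg/suppF0. Qed.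

Lemma suppFD g h : supp gF g -> supp gF h -> supp gF (g + h).
Proof. by move=> hg hh; rewrite -[h]opprK; apply/suppFB/suppFN. Qed.

(** A nonzero homogeneous scalar of degree [g] is invertible, so the part of
    degree [g] is its multiple of the part of degree 0. *)
Lemma suppF_factor g x : supp gF g -> gD g x ->
  exists (c : F) y, gD 0 y /\ x = c *: y.
Proof.
move=> [c gc c0] gx; have cU := gf_div gc c0.
exists c, (c^-1 *: x); split; last by rewrite scalerA divrr// scale1r.
by rewrite -(addNr g); apply: gpartZ => //; apply: gpartV.
Qed.

Lemma D0F_homog g x : supp gF g -> gD g x -> D0Fpred x.
Proof.
move=> hg gx; have [c [y [y0 ->]]] := suppF_factor hg gx.
exact/D0F_scale/D0_D0F.
Qed.

(** Sums of homogeneous elements with degree in the support of [F] form an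
    [F]-subalgebra containing [D_0]. *)
Lemma D0F_sums x : D0Fpred x ->
  sums [set y | exists2 g, supp gF g & gD g y]%classic x.
Proof.
move=> xA; apply: (D0F_ind _ _ _ _ xA) => {x xA}
  [|c x y [r rP ->] hy|x y [r rP ->] [q qP ->]|x x0].
- by apply: sums1; exists 0; [apply: suppF0|apply: gpart1].
- apply: sumsD hy; rewrite scaler_sumr big_seq; apply: sums_sum => z zr.
  have [g hg gz] := rP _ zr.
  have [t tP ->] := gpart_span gF c; rewrite scaler_suml big_seq.
  apply: sums_sum => e /tP[h he]; apply: sums1.
  have [->|e0] := eqVneq e 0; last first.
    by exists (h + g); [apply: suppFD hg; exists e|apply: gpartZ].
  by exists 0; [apply: suppF0|rewrite scale0r; apply: gpart0].
- rewrite mulr_suml big_seq; apply: sums_sum => z /rP[g hg gz].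
  rewrite mulr_sumr big_seq; apply: sums_sum => u /qP[h hh hu].
  by apply: sums1; exists (g + h); [apply: suppFD|apply: gpartM].
- by apply: sums1; exists 0; first exact: suppF0.
Qed.

(** Multiplying an element of [D_0 F] by one of degree [h] gives components in
    the coset of [h] only. *)
Lemma D0F_mul_supp a g h x : gD h x -> gcomp gD g (val a * x) != 0 ->
  supp gF (g - h).
Proof.
move=> hx n0; apply: contrapT => nS; move/eqP: n0; apply.
have [r rP ->] := D0F_sums (valP a).
rewrite mulr_suml gcomp_sum big_seq big1// => y /rP[k hk ky].
rewrite (gcomp_homog _ (gpartM ky hx)); case: eqP => // gE.
by case: nS; rewrite gE addrK.
Qed.

Lemma D0F_supp g a : gA g a -> a != 0 -> supp gF g.
Proof.
move=> ga a0; rewrite -[g]subr0; apply: (@D0F_mul_supp a _ _ 1).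
  exact: gpart1.
by rewrite mulr1 (@gcomp_homog _ _ gD _ _ _ ga) eqxx.
Qed.

(** The inverse of a homogeneous unit whose degree lies in the support of the
    base is again of such a degree, so it stays in the subalgebra. *)
Lemma D0F_homog_unit g a : supp gF g -> gA g a -> a != 0 ->
  a \is a GRing.unit.
Proof.
move=> hg ga a0; have aU : val a \is a GRing.unit.
  exact: cda_div ga _.
have vA : D0Fpred (val a)^-1.
  exact: D0F_homog (suppFN hg) (@gpartV _ _ gD _ _ ga aU).
apply/unitrP; exists (Sub (val a)^-1 vA).
by split; apply: val_inj => /=; rewrite ?mulVr ?divrr.
Qed.

Lemma D0F_commP a :
  (forall d, gD 0 d -> val a * d = d * val a) -> forall b, a * b = b * a.
Proof.
move=> ad b; apply: val_inj => /=.
apply: (@D0F_ind _ _ _ [set z | val a * z = z * val a]%classic) (valP b) => /=.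
- by rewrite mul1r mulr1.
- by move=> c y z hy hz; rewrite mulrDl mulrDr -scalerAl -scalerAr hy hz.
- by move=> y z hy hz; rewrite mulrA hy -mulrA hz mulrA.
- exact: ad.
Qed.

Lemma ZD0F_0 : Z 0.
Proof.
have [Z1 ZL _] := subalg_gen_closed (@ZD0 V F D).
by have := ZL (-1) 1 1 Z1 Z1; rewrite scaleN1r addNr => /set_mem.
Qed.

Lemma ZD0F_D a b : Z a -> Z b -> Z (a + b).
Proof.
have [_ ZL _] := subalg_gen_closed (@ZD0 V F D) => aZ bZ.
by have := ZL 1 _ _ (mem_set aZ) (mem_set bZ); rewrite scale1r => /set_mem.
Qed.

(** The components of a central element commute with [D_0], and each is a
    scalar multiple of an element of [D_0], which lies in [Z(D_0)]. *)
Lemma ZD0F_comp_central a g : (forall b, a * b = b * a) -> Z (gcomp gA g a).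
Proof.
move=> ab; set z := gcomp gA g a.
have gz : gD g (val z) := gcomp_gpart gA g a.
have zd d : gD 0 d -> val z * d = d * val z.
  move=> d0; pose d' : A := Sub d (D0_D0F d0).
  have d'0 : gA 0 d' by [].
  have := congr1 (gcomp gA g) (ab d').
  by rewrite gcompMr// gcompMl// => /(congr1 val).
have [_ ZL _] := subalg_gen_closed (@ZD0 V F D).
have [z0|z0] := eqVneq z 0; first by rewrite z0; apply: ZD0F_0.
have [c gc c0] := D0F_supp gz z0; have cU := gf_div gc c0.
have y0 : gD 0 (c^-1 *: val z).
  by rewrite -(addNr g); apply: gpartZ => //; apply: gpartV.
have yZ : subalg_gen (@ZD0 V F D) (c^-1 *: val z).
  apply: sub_gen_smallest; split=> // d d0.
  by rewrite -scalerAl -scalerAr zd.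
have := ZL c _ _ (mem_set yZ) (mem_set ZD0F_0).
by rewrite scalerA divrr// scale1r addr0 => /set_mem.
Qed.

Lemma ZD0F_center a : Z a <-> forall b, a * b = b * a.
Proof.
split=> [aZ|ab]; first by apply: D0F_commP => d; apply: ZD0F_comm.
have [r ->] := gcomp_span gA a.
by elim/big_ind: _ => [||g _]; [apply: ZD0F_0|apply: ZD0F_D|
  apply: ZD0F_comp_central].
Qed.

(** Write an element of degree in the support of [F] through homogeneous
    generators of [D] and keep the terms of that degree: the generators that
    remain have their degree in the support of [F], hence belong to [D_0 F]. *)
Lemma D0F_gen : exists T : seq D, forall x, D0Fpred x ->
  sums [set z | exists (e : F) y,
    [/\ y \in T, D0Fpred y & z = e *: y]]%classic x.
Proof.
have [T [hT genT]] := cda_gen D; exists T => x /D0F_sums.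
apply: sums_sub; [exact: sums0|exact: sumsD|] => {}x [g hg gx].
have [r rP rE] := genT x.
have hr : {in r, forall z, homogeneous gD z}.
  move=> _ /rP[e [y [[k ke] yT ->]]]; have [h hy] := hT _ yT.
  by exists (k + h); apply: gpartZ.
rewrite (gpart_comp gx hr rE) big_seq_cond.
apply: sums_sum => z /andP[zr /eqP zg].
have [z0|z0] := eqVneq z 0; first by rewrite z0; apply: sums0.
have [e [y [[k ke] yT zE]]] := rP _ zr.
have e0 : e != 0 by apply: contraNneq z0 => e0; rewrite zE e0 scale0r.
have [h hy] := hT _ yT; apply: sums1; exists e, y; split=> //.
suff hh : supp gF h by apply: D0F_homog hh hy.
have gE : g = k + h.
  rewrite -zg; apply: (gpart_disj (gdegP (hr _ zr)) _ z0).
  by rewrite zE; apply: gpartZ.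
have -> : h = g - k by rewrite gE addrC addKr.
by apply: suppFB => //; exists e.
Qed.

Lemma D0F_scalar_proof (e : F) : D0Fpred (e%:A : D).
Proof. by apply: D0F_scale; apply: rpred1. Qed.

Definition D0F_scalar (e : F) : A := Sub (e%:A : D) (D0F_scalar_proof e).

Lemma ZD0F_scalar (e : F) : Z (D0F_scalar e).
Proof.
by apply/ZD0F_center => b; apply: val_inj; rewrite /= mulr_algl mulr_algr.
Qed.

Lemma D0F_fin : exists (n : nat) (b : 'I_n -> A), forall a,
  exists2 c : 'I_n -> A, (forall i, Z (c i)) & a = \sum_i c i * b i.
Proof.
have [T genT] := D0F_gen; exists (size T), (fun i => insubd 0 T`_i) => a.
pose Q := [set z : D | exists2 c : 'I_(size T) -> A, (forall i, Z (c i)) &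
  z = \sum_i val (c i) * val (insubd 0 T`_i : A)]%classic.
have Q0 : Q 0.
  exists (fun=> 0) => [_|]; first exact: ZD0F_0.
  by rewrite big1// => i _; rewrite mul0r.
have QD y z : Q y -> Q z -> Q (y + z).
  move=> [c cZ ->] [d dZ ->]; exists (fun i => c i + d i) => [i|].
    exact: ZD0F_D.
  by rewrite -big_split; apply: eq_bigr => i _; rewrite /= mulrDl.
have Qgen z : (exists (e : F) y, [/\ y \in T, D0Fpred y & z = e *: y]) -> Q z.
  move=> [e [y [yT yA ->]]]; rewrite -index_mem in yT.
  (* a repeated generator gets its coefficient at its first position in T *)
  exists (fun i => if i == Ordinal yT then D0F_scalar e else 0) => [i|].
    by case: eqP => _; [apply: ZD0F_scalar|apply: ZD0F_0].
  rewrite (bigD1 (Ordinal yT))//= eqxx big1 => [|i /negPf->]; last exact: mul0r.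
  have yE : sval (insubd (0 : A) y) = y by have := insubdK (0 : A) yA.
  by rewrite nth_index -?index_mem// yE mulr_algl addr0.
have [c cZ aE] := sums_sub Q0 QD Qgen (genT _ (valP a)).
by exists c => //; apply: val_inj; rewrite aE raddf_sum.
Qed.

(** A nonzero graded ideal contains a nonzero homogeneous element, which is a
    unit. *)
Lemma D0F_simple (I : set A) : gr_ideal gA I -> I = [set 0]%classic \/ I = setT.
Proof.
move=> [I0 ID IM Isp].
have [[a [[g ga] Ia a0]]|no] :=
    pselect (exists a, [/\ homogeneous gA a, I a & a != 0]).
  right; apply/seteqP; split=> // b _.
  have aU := D0F_homog_unit (D0F_supp ga a0) ga a0.
  by rewrite -(mulrVK aU b); apply: (IM _ _ Ia).1.
left; apply/seteqP; split=> [a|_ ->//] /Isp [r rP ->] /=.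
rewrite big_seq big1// => b /rP[hb Ib]; apply: contrapT => /eqP b0.
by apply: no; exists b.
Qed.

Lemma D0F_central_simple : gr_central_simple gA Z.
Proof.
split.
- exact: ZD0F_center.
- move=> a /ZD0F_center aZ; have [r ->] := gcomp_span gA a.
  apply: sums_sum => g _; apply: sums1.
  split; first by exists g; apply: gcomp_gpart.
  exact: ZD0F_comp_central.
- move=> a /ZD0F_center aZ [g ga] a0.
  have aU := D0F_homog_unit (D0F_supp ga a0) ga a0.
  exists a^-1; last exact: divrr.
  by apply/ZD0F_center => b; apply: (mulrI aU); rewrite mulVKr// mulrA aZ mulrK.
- exact: D0F_fin.
- exact: D0F_simple.
Qed.

(** * The factor set given by chosen homogeneous units *)

Lemma D0F_act_zmod_morphism s : zmod_morphism (act s).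
Proof. by move=> a b; apply: val_inj; rewrite /= mulrBr mulrBl. Qed.

Lemma D0F_act_monoid_morphism s : monoid_morphism (act s).
Proof.
have xU := degrep_unit s.
split=> [|a b]; apply: val_inj => /=; first by rewrite mulr1 divrr.
by rewrite !mulrA mulrVK.
Qed.

HB.instance Definition _ (s : G) :=
  GRing.isZmodMorphism.Build A A (act s) (D0F_act_zmod_morphism s).
HB.instance Definition _ (s : G) :=
  GRing.isMonoidMorphism.Build A A (act s) (D0F_act_monoid_morphism s).

Lemma D0F_act_gr s g a : gA g a -> gA g (act s a).
Proof.
move=> ga; have gx := gpart_degrep s.
rewrite /D0F_gr /= /D0F_part /= -[g](addrK (val (degrepr s))) [_ + val _]addrC.
by apply: gpartM; [apply: gpartM|apply/gpartV/degrep_unit].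
Qed.

Lemma D0F_conjV_proof s a : D0Fpred ((xs s)^-1 * val a * xs s).
Proof.
have xU := degrep_unit s; have gx := gpart_degrep s.
have xVU : (xs s)^-1 \is a GRing.unit by rewrite unitrV.
by have := D0F_conj a (gpartV gx xU) xVU; rewrite invrK.
Qed.

Lemma D0F_act_bij s : bijective (act s).
Proof.
have xU := degrep_unit s.
exists (fun a => Sub _ (D0F_conjV_proof s a)) => a; apply: val_inj => /=.
  by rewrite -!mulrA mulKr// mulVr// mulr1.
by rewrite -!mulrA mulVKr// divrr// mulr1.
Qed.

Lemma D0F_act_Z s a : Z a -> Z (act s a).
Proof.
move=> /ZD0F_center aZ; apply/ZD0F_center => b.
have [act' _ actK] := D0F_act_bij s.
by rewrite -(actK b) -!rmorphM aZ.
Qed.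

Lemma degcl0 : degcl 0 = 1%g :> G.
Proof. exact: (raddf0 (\pi_(Quotient.quot (degFz D))%qT)). Qed.

Lemma degclD (g h : GammaD D) : degcl (g + h) = (degcl g * degcl h)%g :> G.
Proof. exact: (raddfD (\pi_(Quotient.quot (degFz D))%qT)). Qed.

(** On the centre, conjugation by a homogeneous unit depends on the class of
    its degree alone ([D0F_actE]), so [1] and [xs s * xs t] may replace the
    chosen representatives. *)
Lemma D0F_gr_action : gr_action gA Z act.
Proof.
split.
- exact: D0F_act_Z.
- move=> a aZ; apply: val_inj.
  have g1 : gD (val (0 : GammaD D)) 1 by apply: gpart1.
  by rewrite -degcl0 (D0F_actE g1)// ?oner_neq0// mul1r invr1 mulr1.
- move=> s t a aZ; apply: val_inj.
  have sU := degrep_unit s; have tU := degrep_unit t.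
  have gst : gD (val (degrepr s + degrepr t)) (xs s * xs t).
    by apply: gpartM; apply: gpart_degrep.
  have n0 : xs s * xs t != 0.
    by apply: unit_neq0; rewrite unitrMl.
  have -> : (s * t)%g = degcl (degrepr s + degrepr t).
    by rewrite degclD !degreprK.
  by rewrite (D0F_actE gst n0 aZ) /= invrM// !mulrA.
- by move=> s a b _ _; rewrite rmorphD.
- by move=> s a b _ _; rewrite rmorphM.
- by move=> s; rewrite rmorph1.
- by move=> s g a _; apply: D0F_act_gr.
Qed.

(** The degree of [xs s * xs t] and that of [xs (s * t)] differ by an element of
    the support of [F]. *)
Lemma D0F_f_proof s t : D0Fpred (xs s * xs t * (xs (s * t)%g)^-1).
Proof.
apply: D0F_homog; last first.
  apply: gpartM; first by apply: gpartM; apply: gpart_degrep.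
  by apply: gpartV (degrep_unit _); apply: gpart_degrep.
apply/(degclP (degrepr s + degrepr t)); rewrite degreprK.
by rewrite degclD !degreprK.
Qed.

Definition D0F_f s t : A := Sub _ (D0F_f_proof s t).

Lemma val_D0F_f s t : val (D0F_f s t) = xs s * xs t * (xs (s * t)%g)^-1.
Proof. by []. Qed.

Lemma D0F_fM s t : val (D0F_f s t) * xs (s * t)%g = xs s * xs t.
Proof. by rewrite val_D0F_f mulrVK// degrep_unit. Qed.

Lemma D0F_f_unit s t : D0F_f s t \is a GRing.unit.
Proof.
have n0 : D0F_f s t != 0.
  apply/eqP => f0; have : xs s * xs t != 0.
    by apply: unit_neq0; rewrite unitrMl ?degrep_unit.
  by rewrite -D0F_fM f0 mul0r eqxx.
have gf : gA (val (degrepr s) + val (degrepr t) - val (degrepr (s * t)%g))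
    (D0F_f s t).
  apply: gpartM; first by apply: gpartM; apply: gpart_degrep.
  by apply: gpartV (degrep_unit _); apply: gpart_degrep.
exact: D0F_homog_unit (D0F_supp gf n0) gf n0.
Qed.

Lemma D0F_act_comp s t a :
  act s (act t a) = D0F_f s t * act (s * t)%g a * (D0F_f s t)^-1.
Proof.
have fU := D0F_f_unit s t; have sU := degrep_unit s; have tU := degrep_unit t.
apply: (mulIr fU); rewrite mulrVK//; apply: val_inj; rewrite /= -!mulrA.
by rewrite !mulKr// degrep_unit.
Qed.

Lemma D0F_cocycle s t u : D0F_f s t * D0F_f (s * t)%g u =
  act s (D0F_f t u) * D0F_f s (t * u)%g.
Proof.
by apply: val_inj; rewrite /= -!mulrA !mulKr ?degrep_unit// mulgA.
Qed.

Definition D0F_factor_set : gr_factor_set gA Z act :=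
  @GrFactorSet V A gA Z G act D0F_central_simple D0F_gr_action
    (fun s => act s) D0F_f D0F_act_bij D0F_act_gr D0F_f_unit
    (fun _ _ _ => erefl) D0F_act_comp D0F_cocycle.

(** * The isomorphism with the crossed product *)

Local Notation C := (crossed D0F_factor_set).
Implicit Types u v : C.

Definition crossed_eval u : D := \sum_s val (u s) * xs s.

Lemma crossed_eval_mono a s :
  crossed_eval (cpmono D0F_factor_set a s) = val a * xs s.
Proof.
rewrite /crossed_eval (bigD1 s)//= ffunE eqxx big1 ?addr0// => t /negPf ts.
by rewrite ffunE ts mul0r.
Qed.

Lemma crossed_eval_zmod_morphism : zmod_morphism crossed_eval.
Proof.
move=> u v; rewrite /crossed_eval -sumrB; apply: eq_bigr => s _.
by rewrite !ffunE /= mulrBl.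
Qed.

HB.instance Definition _ :=
  GRing.isZmodMorphism.Build C D crossed_eval crossed_eval_zmod_morphism.

Lemma D0F_f11V : val (fs_f D0F_factor_set 1%g 1%g)^-1 = (xs 1%g)^-1.
Proof.
rewrite rmorphV ?D0F_f_unit//; congr (_^-1).
by rewrite /= mulg1 mulrK// degrep_unit.
Qed.

Lemma crossed_eval_monoid_morphism : monoid_morphism crossed_eval.
Proof.
split=> [|u v].
  rewrite [LHS]crossed_eval_mono D0F_f11V.
  by rewrite mulVr// degrep_unit.
rewrite [_ * _]/(cpmul u v) /cpmul raddf_sum [in RHS]/crossed_eval mulr_suml.
apply: eq_bigr => s _; rewrite raddf_sum mulr_sumr; apply: eq_bigr => t _.
rewrite /= crossed_eval_mono /= -!mulrA.
by rewrite !mulKr ?mulVr ?mulr1 ?degrep_unit.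
Qed.

HB.instance Definition _ :=
  GRing.isMonoidMorphism.Build C D crossed_eval crossed_eval_monoid_morphism.

(** The summands [val (u s) * xs s] have their components in pairwise distinct
    cosets of the support of [F], so no cancellation can occur among them. *)
Lemma crossed_eval_inj : injective crossed_eval.
Proof.
apply: raddf_inj => u u0; apply/ffunP => s; rewrite ffunE; apply: val_inj.
apply: (mulIr (degrep_unit s)); rewrite mul0r.
apply: (@gcomp_eq0 _ _ gD) => g; apply: contrapT => /eqP n0.
have := congr1 (gcomp gD g) u0; rewrite gcomp0 /crossed_eval gcomp_sum.
rewrite (bigD1 s)//= big1 ?addr0 => [/eqP|t ts]; first exact/negP.
apply: contrapT => /eqP n0'; case/eqP: ts.
rewrite -(degreprK s) -(degreprK t); apply/degclP.
have hs := D0F_mul_supp (gpart_degrep s) n0.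
have ht := D0F_mul_supp (gpart_degrep t) n0'.
by have := suppFB hs ht; rewrite opprB addrC addrA subrK.
Qed.

(** A homogeneous [x] of degree [g] is divided by the chosen unit in the class
    of [g]; the quotient has its degree in the support of [F]. *)
Lemma crossed_eval_surj x : exists u, crossed_eval u = x.
Proof.
pose Q := [set y | exists u, crossed_eval u = y]%classic.
apply: (@sums_sub _ _ Q _ _ _ _ (gpart_span gD x)) =>
  [|y z [u <-] [v <-]|y [g gy]].
- by exists 0; rewrite raddf0.
- by exists (u + v); rewrite raddfD.
have [->|y0] := eqVneq y 0; first by exists 0; rewrite raddf0.
have dg : degD D g by apply/asboolP; exists y.
pose s : G := degcl (Sub g dg); have sU := degrep_unit s.
have yA : D0Fpred (y * (xs s)^-1).
  apply: D0F_homog; last by apply: gpartM gy (gpartV (gpart_degrep s) sU).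
  by apply/(degclP (Sub g dg)); rewrite degreprK.
exists (cpmono _ (Sub _ yA) s).
by rewrite crossed_eval_mono /= mulrVK.
Qed.

Lemma crossed_eval_bij : bijective crossed_eval.
Proof.
have [psi psiK] := choice crossed_eval_surj.
exists psi; last exact: psiK.
by move=> u; apply: crossed_eval_inj; rewrite psiK.
Qed.

Lemma crossed_eval_incl a :
  crossed_eval (cpincl D0F_factor_set a) = val a.
Proof.
rewrite crossed_eval_mono -[val (a * _)]/(val a * val _) D0F_f11V.
by rewrite mulrVK// degrep_unit.
Qed.

Lemma crossed_eval_x s : crossed_eval (cpx D0F_factor_set s) = xs s.
Proof. by rewrite crossed_eval_mono mul1r. Qed.

End CrossedProductStructure.

(** * Transport of a grading along an isomorphism *)

Section Pullback.
Variables (V : zmodType) (R S : nzRingType) (gr : grading V S).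
Variables (phi : {rmorphism R -> S}) (phi_bij : bijective phi).

Definition pullback_part (g : V) : set R := [set x | gr g (phi x)]%classic.

Lemma pullback0 g : pullback_part g 0.
Proof. by rewrite /pullback_part /= rmorph0; apply: gpart0. Qed.

Lemma pullbackB g x y :
  pullback_part g x -> pullback_part g y -> pullback_part g (x - y).
Proof. by rewrite /pullback_part /= rmorphB; apply: gpartB. Qed.

Lemma pullback1 : pullback_part 0 1.
Proof. by rewrite /pullback_part /= rmorph1; apply: gpart1. Qed.

Lemma pullbackM g h x y :
  pullback_part g x -> pullback_part h y -> pullback_part (g + h) (x * y).
Proof. by rewrite /pullback_part /= rmorphM; apply: gpartM. Qed.

Lemma pullback_span x : sums [set y | exists g, pullback_part g y]%classic x.
Proof.
have [psi phiK psiK] := phi_bij; have [r rP xE] := gpart_span gr (phi x).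
exists (map psi r).
  by move=> _ /mapP[y /rP[g gy] ->]; exists g; rewrite /pullback_part /= psiK.
rewrite -[x]phiK; apply: (can_inj phiK); rewrite psiK xE rmorph_sum big_map.
by apply: eq_bigr => y _; rewrite psiK.
Qed.

Lemma pullback_free (s : seq V) (c : V -> R) : uniq s ->
  (forall g, pullback_part g (c g)) -> \sum_(g <- s) c g = 0 ->
  {in s, forall g, c g = 0}.
Proof.
move=> us cP /(congr1 phi); rewrite rmorph_sum rmorph0 => s0 g gs.
apply: (bij_inj phi_bij); rewrite rmorph0.
exact: (gpart_free us cP s0).
Qed.

Definition pullback : grading V R :=
  Grading pullback0 pullbackB pullback1 pullbackM pullback_span pullback_free.

End Pullback.

Theorem mainTheorem8 (V : zmodType) (tfV : torsion_free V)
    (F : gradedField V) (D : gradedCDA F) :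
  exists (fs : gr_factor_set (D0F_gr D) (@ZD0F V F D)
                 (H := GammaDF D) (@D0F_act V F D))
         (grC : grading V (crossed fs))
         (phi : {rmorphism crossed fs -> D}),
    [/\ crossed_grading grC,
        bijective phi,
        forall (g : V) (u : crossed fs), grC g u <-> cda_gr D g (phi u) &
        forall a : D0F D, phi (cpincl fs a) = val a].
Proof.
pose phi : {rmorphism crossed (D0F_factor_set D) -> D} := @crossed_eval V F D.
have phi_bij : bijective phi := crossed_eval_bij D.
exists (D0F_factor_set D), (pullback (cda_gr D) phi_bij), phi.
split=> //; last exact: crossed_eval_incl.
split=> [g a|s].
  by rewrite /= /pullback_part /= crossed_eval_incl.
exists (val (degrepr s)).
by rewrite /= /pullback_part /= crossed_eval_x; apply: gpart_degrep.
Qed.
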